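(* Let $(\kappa_n)_n$ be any increasing sequence of integers. Then there is a positive constant $C$, independent of $m$ and $n$, such that for all integers $n>m\geqslant 2$, $$\Big|(\kappa_n-\kappa_m)P(T_m^n=\kappa_n-\kappa_m)-P\big((\kappa_n-\kappa_m)-n\leqslant T_m^n\leqslant(\kappa_n-\kappa_m)-(m+1)\big)\Big|\leqslant C\,\frac{1+\log\frac nm}{\sqrt{n-m}}.$$
   Context: $(Z_k)_{k\geqslant 1}$ are independent random variables with $P(Z_k=1)=\frac1k$ and $P(Z_k=0)=1-\frac1k$ for each $k$. For integers $0\leqslant m<n$, $T_m^n=\sum_{k=m+1}^n kZ_k$. *)

(* Defs.v *)
From HB Require Import structures.
From mathcomp Require Import all_boot all_order all_algebra finmap.
From mathcomp Require Import all_classical all_reals all_analysis.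

Set Implicit Arguments.
Unset Strict Implicit.
Unset Printing Implicit Defensive.

Import Order.TTheory GRing.Theory Num.Theory.
Import numFieldNormedType.Exports.

Local Open Scope classical_set_scope.
Local Open Scope ring_scope.

Definition mutually_independent (d : measure_display) (Omega : measurableType d)
    (R : realType) (P : probability Omega R) (I : choiceType) (D : set I)
    (X : I -> {RV P >-> R}) : Prop :=
  forall (J : {fset I}) (B : I -> set R),
    [set` J] `<=` D ->
    (forall i : I, i \in J -> measurable (B i)) ->
    P (\bigcap_(i in [set` J]) (X i @^-1` B i)) =
      (\prod_(i <- J) P (X i @^-1` B i))%E.

(* T_m^n *)
Definition Tsum (Omega : Type) (R : realType) (Z : nat -> Omega -> R)
    (m n : nat) (w : Omega) : R :=
  \sum_(m.+1 <= k < n.+1) k%:R * Z k w.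

(* Main.v *)
(** The probability generating function [G] of [T_m^n] is the product of the
    [1 - 1/k + X^k/k], and [G_k] denotes the same product without the factor
    [k].  Since the factor [k] has derivative [X^(k-1)], [X G'] is the sum of
    the [X^k G_k]; hence [D P(T = D) - P(D - n <= T <= D - m - 1)] is the sum over
    [k] of [1/k] times the coefficient of [X^D] in [X^k G_k - X^2k G_k].
    It remains to bound the coefficients of [G_k <= 3/2 G].  As [T < j] forces
    [Z_k = 0] for all [k >= j], [P(T < j) <= j/n] for [j >= m], and then
    [X G'] again gives [j P(T = j) <= 3/2 P(T < j)], so that
    [P(T = j) <= 3/(2n)] for [j >= 1]; also [P(T = 0) <= m/n].  Summing over [k]
    yields the error [O((1 + log(n/m))/n)], and [n >= sqrt(n - m)]. *)

Require Import Defs.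
From HB Require Import structures.
From mathcomp Require Import all_boot all_order all_algebra finmap.
From mathcomp Require Import all_classical all_reals all_analysis.
From mathcomp Require Import measurable_realfun lra ring zify.
Import Order.TTheory GRing.Theory Num.Theory.
Import numFieldNormedType.Exports.

Local Open Scope classical_set_scope.
Local Open Scope ring_scope.

(** Since [s] has no repetition, the filter [j != i] removes exactly one factor, and the Leibniz
    rule applies by induction on [s]. *)
Lemma deriv_prod_uniq {R : comNzRingType} {I : eqType} (s : seq I)
    (F : I -> {poly R}) : uniq s ->
  (\prod_(i <- s) F i)^`() =
  \sum_(i <- s) (F i)^`() * \prod_(j <- s | j != i) F j.
Proof.
elim: s => [|x s IHs] /=; first by rewrite !big_nil derivC.
case/andP=> xNs us; rewrite !big_cons derivM IHs // eqxx /=; congr (_ + _).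
  congr (_ * _); rewrite big_seq [RHS]big_seq_cond; apply: eq_bigl => i.
  by case: (boolP (i \in s)) => //= si; apply/esym; apply: contraNneq xNs => <-.
rewrite mulr_sumr; apply: eq_big_seq => i si.
rewrite big_cons ifT 1?mulrCA //.
by apply: contraNneq xNs => ->.
Qed.

(** * Generating function of the sum and its products with one factor removed *)

Section GeneratingFunction.
Context {R : realFieldType}.
Implicit Types (m n k j : nat) (p : {poly R}).

Definition genf1 k : {poly R} := (1 - k%:R^-1)%:P + k%:R^-1 *: 'X^k.

Definition genf m n : {poly R} := \prod_(m.+1 <= k < n.+1) genf1 k.

Definition genf_except m n k : {poly R} :=
  \prod_(m.+1 <= l < n.+1 | l != k) genf1 l.

Lemma invn_le1 k : (k%:R^-1 : R) <= 1.
Proof.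
case: k => [|k]; first by rewrite invr0.
by rewrite invf_le1 ?ltr0n// ler1n.
Qed.

Lemma genf1_ge0 k j : 0 <= (genf1 k)`_j.
Proof.
rewrite coefD coefC coefZ coefXn addr_ge0//.
by case: ifP => // _; rewrite subr_ge0 invn_le1.
Qed.

Lemma prod_genf1_ge0 (s : seq nat) (Q : pred nat) j :
  0 <= (\prod_(k <- s | Q k) genf1 k)`_j.
Proof.
elim/big_rec: _ j => [|k p _ p0] j; first by rewrite coef1.
by rewrite coefM sumr_ge0// => i _; rewrite mulr_ge0// genf1_ge0.
Qed.

Lemma genf_ge0 m n j : 0 <= (genf m n)`_j.
Proof. exact: prod_genf1_ge0. Qed.

Lemma genf_except_ge0 m n k j : 0 <= (genf_except m n k)`_j.
Proof. exact: prod_genf1_ge0. Qed.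

Lemma genf_exceptE m n k : (m < k <= n)%N ->
  genf m n = genf1 k * genf_except m n k.
Proof.
move=> mkn; rewrite /genf (bigD1_seq k) ?iota_uniq//=.
by rewrite mem_index_iota ltnS.
Qed.

Lemma genf_recr m n : (m <= n)%N -> genf m n.+1 = genf m n * genf1 n.+1.
Proof. by move=> mn; rewrite /genf big_nat_recr. Qed.

Lemma coef_genf1M k p j :
  (genf1 k * p)`_j = (1 - k%:R^-1) * p`_j + k%:R^-1 * (p * 'X^k)`_j.
Proof. by rewrite mulrDl -mul_polyC coefD coefCM -mulrA coefCM commr_polyXn. Qed.

(** * Size-bias identity and bounds on coefficients *)

Lemma size_biased m n j :
  j%:R * (genf m n)`_j = \sum_(m.+1 <= k < n.+1) (genf_except m n k * 'X^k)`_j.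
Proof.
have -> : j%:R * (genf m n)`_j = ('X * (genf m n)^`())`_j.
  by rewrite coefXM; case: j => [|j]; rewrite ?mul0r// coef_deriv mulr_natl.
rewrite /genf deriv_prod_uniq ?iota_uniq// mulr_sumr coef_sum.
rewrite big_nat_cond [RHS]big_nat_cond; apply: eq_bigr => k /andP[/andP[mk _] _].
have k0 : (0 < k)%N by exact: leq_ltn_trans mk.
rewrite /genf_except mulrA mulrC; congr (polyseq (_ * _))`_j.
rewrite /genf1 derivD derivC add0r derivZ derivXn -scalerAr mulrnAr -exprS.
by rewrite prednK// -['X^k *+ k]scaler_nat scalerA mulVf ?scale1r// pnatr_eq0 -lt0n.
Qed.

(** Dropping the nonnegative part of [genf1 k] that carries ['X^k] leaves [1 - 1/k] times
    [genf_except m n k], and [1 - 1/k >= 2/3] because [k >= 3]. *)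
Lemma genf_except_le m n k j : (2 <= m)%N -> (m < k <= n)%N ->
  (genf_except m n k)`_j <= 3 / 2 * (genf m n)`_j.
Proof.
move=> m2 mkn; rewrite (genf_exceptE _ _ _ mkn) coef_genf1M.
have h : (k%:R^-1 : R) <= 1 / 3.
  rewrite -[leRHS]invrK lef_pV2 ?posrE ?ltr0n; [|lia|lra].
  by rewrite invf_div divr1 (ler_nat _ 3); lia.
have k0 : 0 <= (k%:R^-1 : R) by rewrite invr_ge0 ler0n.
have g0 := genf_except_ge0 m n k j.
have : 0 <= k%:R^-1 * (genf_except m n k * 'X^k)`_j.
  by rewrite mulr_ge0// coefMXn; case: ifP => // _; exact: genf_except_ge0.
nra.
Qed.

Lemma genf_horner1 m n : (genf m n).[1] = 1.
Proof.
rewrite horner_prod big1// => k _.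
by rewrite !hornerE expr1n; ring.
Qed.

Lemma genf_sum_le1 m n N : \sum_(i < N) (genf m n)`_i <= 1.
Proof.
(* The value 1 of the polynomial at 1 is the sum of all its coefficients; taking the sum up to the
   maximum covers [N] on either side of the size. *)
rewrite -[leRHS](genf_horner1 m n) (@horner_coef_wide _ (maxn N (size (genf m n)))).
  rewrite -(big_mkord xpredT (fun i => (genf m n)`_i)).
  rewrite -(big_mkord xpredT (fun i => (genf m n)`_i * 1 ^+ i)).
  rewrite (@big_cat_nat _ _ _ N 0 (maxn _ _))//= ?leq_maxl//.
  under [X in X + _]eq_bigr do rewrite expr1n mulr1.
  rewrite lerDl sumr_ge0// => i _; rewrite expr1n mulr1; exact: genf_ge0.
exact: leq_maxr.
Qed.

(** Induction on [n] from [m]. As long as the new index [n + 1] is at least [j], the term in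
    ['X^(n + 1)] does not reach the coefficients below [j], so their sum is multiplied by
    [n / (n + 1)] and [n] times the sum stays constant. Once [j] exceeds the index, total mass 1
    suffices. *)
Lemma genf_sum_le m n j : (m <= n)%N -> (m <= j)%N ->
  n%:R * \sum_(i < j) (genf m n)`_i <= j%:R.
Proof.
move=> /subnKC <-; elim: (n - m)%N => [|t IHt] mj.
  rewrite addn0 -[leRHS]mulr1 ler_pM ?ler_nat ?genf_sum_le1 ?sumr_ge0// => i _.
  exact: genf_ge0.
rewrite addnS; have [jn|nj] := leqP j (m + t).+1; last first.
  rewrite -[leRHS]mulr1 ler_pM ?ler_nat ?genf_sum_le1 ?sumr_ge0//; last by lia.
  by move=> i _; exact: genf_ge0.
apply: le_trans (IHt mj); rewrite genf_recr ?leq_addr// mulrC.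
rewrite le_eqVlt; apply/orP; left; apply/eqP.
rewrite mulr_suml mulr_sumr; apply: eq_bigr => i _.
rewrite mulrC [_ * genf1 _]mulrC coef_genf1M coefMXn (leq_trans (ltn_ord i) jn).
rewrite mulr0 addr0 mulrA mulrBr mulfV ?pnatr_eq0// mulr1.
by rewrite -addn1 natrD addrK.
Qed.

Lemma genf_le m n j : (2 <= m < n)%N -> (0 < j)%N ->
  n%:R * (genf m n)`_j <= 3 / 2.
Proof.
move=> /andP[m2 mn] j0.
have j0R : 0 < j%:R :> R by rewrite ltr0n.
have jg : j%:R * (genf m n)`_j <=
    3 / 2 * \sum_(m.+1 <= k < n.+1) (genf m n * 'X^k)`_j.
  rewrite size_biased mulr_sumr; apply: ler_sum_nat => k /andP[mk kn].
  rewrite !coefMXn; case: ifP => _; first by rewrite mulr0.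
  by apply: genf_except_le => //; rewrite mk.
(* For [0 < j <= m] every shift [k > m] exceeds [j], so the bound [jg] is zero; the other case meets
   the condition of [genf_sum_le]. *)
have [jm|mj] := leqP j m.
  suff -> : (genf m n)`_j = 0 by rewrite mulr0; lra.
  apply/eqP; rewrite eq_le genf_ge0 andbT -(pmulr_rle0 _ j0R).
  apply: le_trans jg _; rewrite big_nat_cond big1 ?mulr0// => k.
  by case/andP=> /andP[mk _] _; rewrite coefMXn (leq_ltn_trans jm mk).
have sle : \sum_(m.+1 <= k < n.+1) (genf m n * 'X^k)`_j <=
    \sum_(i < j) (genf m n)`_i.
  apply: (@le_trans _ _ (\sum_(m.+1 <= k < j.+1) (genf m n)`_(j - k))).
    have [nj|jn] := leqP n j.
      rewrite (@big_cat_nat _ _ _ n.+1 m.+1 j.+1)/=; [|lia|lia].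
      rewrite -[leLHS]addr0 lerD//.
        apply: ler_sum_nat => k /andP[_ kn].
        by rewrite coefMXn ltnNge (leq_trans _ nj).
      by rewrite sumr_ge0// => i _; exact: genf_ge0.
    rewrite (@big_cat_nat _ _ _ j.+1 m.+1 n.+1)/=; [|lia|lia].
    rewrite [X in _ + X]big_nat_cond [X in _ + X]big1 ?addr0; last first.
      by move=> k /andP[/andP[jk _] _]; rewrite coefMXn jk.
    by apply: ler_sum_nat => k /andP[_ kj]; rewrite coefMXn ltnNge -ltnS kj.
  (* As [k] runs from [m + 1] to [j], [j - k] runs through the first [j - m] indices; reversing the
     right-hand sum matches these and leaves nonnegative terms. *)
  rewrite -(big_mkord xpredT (fun i => (genf m n)`_i)) big_add1/=.
  rewrite [leRHS]big_nat_rev /= (@big_cat_nat _ _ _ m 0 j)//=; last exact: ltnW.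
  rewrite -[leLHS]add0r lerD ?sumr_ge0//; first by move=> i _; exact: genf_ge0.
have n0 : 0 <= n%:R :> R by rewrite ler0n.
rewrite -(ler_pM2l j0R) mulrCA.
apply: (@le_trans _ _ (n%:R * (3 / 2 * \sum_(i < j) (genf m n)`_i))).
  by rewrite ler_wpM2l// (le_trans jg)// ler_wpM2l//; lra.
by rewrite mulrCA mulrC ler_wpM2r ?genf_sum_le ?(ltnW mn) ?(ltnW mj)//; lra.
Qed.

Lemma genf0_le m n : (0 < m <= n)%N -> n%:R * (genf m n)`_0 <= m%:R.
Proof.
move=> /andP[m0 mn]; apply: le_trans (genf_sum_le m n m mn (leqnn m)).
rewrite ler_wpM2l// -(big_mkord xpredT (fun i => (genf m n)`_i)) big_ltn//=.
by rewrite lerDl sumr_ge0// => i _; exact: genf_ge0.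
Qed.

(** * Error term of the size-bias identity *)

Lemma size_bias_error m n j :
  j%:R * (genf m n)`_j - \sum_(m.+1 <= k < n.+1) (genf m n * 'X^k)`_j =
  \sum_(m.+1 <= k < n.+1) k%:R^-1 *
    ((genf_except m n k * 'X^k)`_j - (genf_except m n k * 'X^(k + k))`_j).
Proof.
rewrite size_biased -sumrB big_nat_cond [RHS]big_nat_cond.
apply: eq_bigr => k /andP[mkn _].
rewrite (genf_exceptE m n k mkn) -mulrA coef_genf1M -mulrA -exprD; ring.
Qed.

(** Three cases. The coefficient vanishes for [j < d]. For [j > d], [genf_except_le] and [genf_le]
    each cost a factor [3/2], whence [9/4]. For [j = d] the constant coefficient is only [O(m/n)],
    and the weight [1/k] is spent on [m/k <= 1]. *)
Lemma genf_except_shift_le m n k d j : (2 <= m)%N -> (m < k <= n)%N ->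
    (k <= d)%N ->
  k%:R^-1 * (genf_except m n k * 'X^d)`_j <=
  n%:R^-1 * (3 / 2 * (j == d)%:R + 9 / 4 * k%:R^-1).
Proof.
move=> m2 mkn kd; have /andP[mk kn] := mkn.
have n0 : 0 < n%:R :> R by rewrite ltr0n; lia.
have k0 : 0 < k%:R :> R by rewrite ltr0n; lia.
have k'0 : 0 < k%:R^-1 :> R by rewrite invr_gt0.
rewrite -(ler_pM2l n0) mulVKf ?lt0r_neq0// coefMXn.
have [jd|dj|->] := ltngtP j d.
- by rewrite !mulr0 add0r mulr_ge0 ?ltW//; lra.
- rewrite mulr0 add0r mulrCA mulrC ler_pM2r//.
  have [mn j0] : (2 <= m < n)%N /\ (0 < j - d)%N by lia.
  have := genf_le m n (j - d) mn j0.
  have := genf_except_le m n k (j - d) m2 mkn.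
  move=> /(ler_wpM2l (ltW n0)); lra.
- rewrite subnn mulrCA mulr1.
  have ge := genf_except_le m n k 0 m2 mkn.
  have g0 := genf0_le m n ltac:(lia).
  have mk1 : k%:R^-1 * m%:R <= 1 :> R.
    by rewrite mulrC ler_pdivrMr// mul1r ler_nat ltnW.
  apply: (@le_trans _ _ (3 / 2 * (k%:R^-1 * m%:R))); last by lra.
  rewrite [leRHS]mulrCA ler_pM2l//.
  by move: ge => /(ler_wpM2l (ltW n0)); lra.
Qed.

(** An injective [f] meets [j] at most once, so the exceptional case [j = d] above is paid for once
    per family of shifts rather than for every [k]. *)
Lemma sum_nat_eq_le1 m n j (f : nat -> nat) : injective f ->
  \sum_(m <= k < n) (j == f k)%:R <= 1 :> R.
Proof.
move=> f_inj; elim: n => [|n IHn]; first by rewrite big_geq ?ler01.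
have [nm|mn] := ltnP n m; first by rewrite big_geq ?ler01.
rewrite big_nat_recr//=; have [jE|_] := eqVneq j (f n); last by rewrite addr0.
rewrite big_nat_cond big1 ?add0r// => k /andP[/andP[_ kn] _].
by rewrite jE (inj_eq f_inj) gtn_eqF.
Qed.

Lemma size_bias_error_le m n j : (2 <= m < n)%N ->
  `|j%:R * (genf m n)`_j - \sum_(m.+1 <= k < n.+1) (genf m n * 'X^k)`_j| <=
  n%:R^-1 * (3 + 9 / 2 * \sum_(m.+1 <= k < n.+1) k%:R^-1).
Proof.
move=> /andP[m2 mn]; rewrite size_bias_error.
apply: le_trans (ler_norm_sum _ _ _) _.
(* The shifts [k] and [k + k] are each bounded separately: [9/4] doubles to [9/2], and the two
   diagonal terms sum to at most [3/2] each, hence 3. *)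
apply: (@le_trans _ _ (\sum_(m.+1 <= k < n.+1) n%:R^-1 *
    (3 / 2 * ((j == k)%:R + (j == k + k)%:R) + 9 / 2 * k%:R^-1))).
  apply: ler_sum_nat => k mkn.
  have k0 : 0 <= k%:R^-1 :> R by rewrite invr_ge0 ler0n.
  rewrite normrM (ger0_norm k0).
  have u := genf_except_shift_le m n k k j m2 mkn (leqnn k).
  have v := genf_except_shift_le m n k (k + k) j m2 mkn (leq_addr k k).
  have p d : 0 <= (genf_except m n k * 'X^d)`_j.
    by rewrite coefMXn; case: ifP => // _; exact: genf_except_ge0.
  have := ler_normB (genf_except m n k * 'X^k)`_j
                    (genf_except m n k * 'X^(k + k))`_j.
  rewrite !(ger0_norm (p _)) => /(ler_wpM2l k0); lra.
rewrite -mulr_sumr ler_wpM2l ?invr_ge0 ?ler0n// big_split/= -!mulr_sumr big_split/=.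
have := sum_nat_eq_le1 m.+1 n.+1 j id (@inj_id _).
have := sum_nat_eq_le1 m.+1 n.+1 j (fun k => k + k)%N ltac:(by move=> ? ?; lia).
lra.
Qed.

(** * Expectations under a law given by a polynomial *)

(* [sumcoef f p] is the expectation of [f] under the law with generating
   function [p]. *)
Definition sumcoef (f : nat -> R) p : R := \sum_(i < size p) p`_i * f i.

Lemma sumcoef_wide f p N : (size p <= N)%N -> sumcoef f p = \sum_(i < N) p`_i * f i.
Proof.
move=> pN; rewrite /sumcoef (big_ord_widen N (fun i => p`_i * f i) pN).
rewrite big_mkcond; apply: eq_bigr => i _ /=.
by case: ltnP => // pi; rewrite nth_default// mul0r.
Qed.

Lemma sumcoef1 f : sumcoef f 1 = f 0%N.
Proof. by rewrite /sumcoef size_poly1 big_ord1 coef1 mul1r. Qed.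

Lemma sumcoefMXn f p k :
  sumcoef f (p * 'X^k) = sumcoef (fun i => f (k + i)%N) p.
Proof.
have sM : (size (p * 'X^k)%R <= k + size p)%N.
  by apply: leq_trans (size_polyMleq _ _) _; rewrite size_polyXn addnS/= addnC.
rewrite (sumcoef_wide _ _ _ sM) big_split_ord/= big1 ?add0r => [|i _].
  by apply: eq_bigr => i _; rewrite coefMXn ltnNge leq_addr/= addKn.
by rewrite coefMXn ltn_ord mul0r.
Qed.

(** Polynomial counterpart of conditioning on [Z k]: value 0 keeps the argument of [f], value 1
    shifts it by [k]. *)
Lemma sumcoef_genf1M f p k :
  sumcoef f (p * genf1 k) =
  (1 - k%:R^-1) * sumcoef f p + k%:R^-1 * sumcoef (fun i => f (k + i)%N) p.
Proof.
rewrite -sumcoefMXn; set q := p * 'X^k.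
have [N [hpk hp hq]] : exists N,
    [/\ size (p * genf1 k)%R <= N, size p <= N & size q <= N]%N.
  exists (maxn (size (p * genf1 k)%R) (maxn (size p) (size q))).
  by rewrite !leq_max !leqnn !orbT.
rewrite (sumcoef_wide f _ _ hpk) (sumcoef_wide f _ _ hp) (sumcoef_wide f _ _ hq).
rewrite !mulr_sumr -big_split/=; apply: eq_bigr => i _.
rewrite (mulrC p) coef_genf1M; ring.
Qed.

Lemma sumcoef_eq j p : sumcoef (fun i => (i == j)%:R) p = p`_j.
Proof.
rewrite (sumcoef_wide _ _ _ (leq_maxl (size p) j.+1)).
have jN : (j < maxn (size p) j.+1)%N by rewrite leq_max leqnn orbT.
rewrite (bigD1 (Ordinal jN))//= eqxx mulr1 big1 ?addr0// => i /negPf.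
by rewrite -val_eqE/= => ->; rewrite mulr0.
Qed.

Lemma sumcoef_sum (s : seq nat) (f : nat -> nat -> R) p :
  sumcoef (fun i => \sum_(k <- s) f k i) p = \sum_(k <- s) sumcoef (f k) p.
Proof.
by rewrite /sumcoef exchange_big/=; apply: eq_bigr => i _; rewrite mulr_sumr.
Qed.

End GeneratingFunction.

(** * Comparison of the harmonic sum with the logarithm *)

(** From [ln (1 - 1/k) <= - 1/k] one gets [1/k <= ln k - ln (k - 1)], which telescopes. *)
Lemma sum_inv_le_ln {R : realType} (m n : nat) : (0 < m <= n)%N ->
  \sum_(m.+1 <= k < n.+1) k%:R^-1 <= ln (n%:R / m%:R) :> R.
Proof.
move=> /andP[m0 mn].
have pos k : (0 < k)%N -> k%:R \in @Num.pos R by rewrite posrE ltr0n.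
rewrite ln_div ?pos//; last exact: leq_trans mn.
rewrite -(telescope_sumr (fun k => ln (k%:R : R)) mn) big_add1/=.
apply: ler_sum_nat => k /andP[mk _].
have k0 : (0 < k)%N by exact: leq_trans mk.
have k1 : 0 < k.+1%:R :> R by rewrite ltr0n.
rewrite -lerN2 opprB -ln_div ?pos//.
have -> : k%:R / k.+1%:R = 1 + - k.+1%:R^-1 :> R.
  by rewrite -[k%:R](addrK 1) natr1 mulrBl divff ?div1r// lt0r_neq0.
apply: le_ln1Dx; rewrite ltrN2 invf_lt1// ltr1n ltnS//.
Qed.

(** * Law of the sum, obtained from independence *)

Section TsumLaw.
Context {R : realType} {d : measure_display} {Omega : measurableType d}.
Context {P : probability Omega R}.

(** The complement of [A] and [B] is a null set. This serves to condition on [Z k], which is 0 or 1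
    only almost surely. *)
Lemma probability_split (A B W : set Omega) :
    measurable A -> measurable B -> measurable W -> A `&` B = set0 ->
    (P A + P B = 1)%E ->
  (P W = P (W `&` A) + P (W `&` B))%E.
Proof.
move=> mA mB mW AB PAB; have mAB : measurable (A `|` B) by exact: measurableU.
have P0 : (P (W `&` ~` (A `|` B)) = 0)%E.
  apply/eqP; rewrite eq_le measure_ge0 andbT.
  have -> : (0 = P (~` (A `|` B)))%E.
    by rewrite probability_setC// measureU// PAB subee.
  by apply: measureIr => //; exact: measurableC.
have {1}-> : W = (W `&` (A `|` B)) `|` (W `&` ~` (A `|` B)).
  by rewrite -setIUr setUCr setIT.
rewrite measureU0 //; [|exact: measurableI|by apply: measurableI => //; exact: measurableC].
rewrite setIUr measureU//; [exact: measurableI|exact: measurableI|].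
by rewrite setIACA AB setI0.
Qed.

Context (Z : nat -> {RV P >-> R}).
Context (Zindep : mutually_independent [set k : nat | (1 <= k)%N] Z).
Context (Z1 : forall k : nat, (1 <= k)%N ->
  P [set w | Z k w = 1] = ((k%:R)^-1)%:E).
Context (Z0 : forall k : nat, (1 <= k)%N ->
  P [set w | Z k w = 0] = (1 - (k%:R)^-1)%:E).

Lemma measurable_Tsum m n : measurable_fun setT (Tsum Z m n).
Proof.
by apply: measurable_sum => k; apply: measurable_funM.
Qed.

Lemma measurable_Tsum_preimage m n (A : set R) : measurable A ->
  measurable (Tsum Z m n @^-1` A).
Proof. by move=> mA; rewrite -[X in measurable X]setTI; exact: measurable_Tsum. Qed.

Lemma measurable_bigcap_preimage (J : {fset nat}) (B : nat -> set R) :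
  (forall i, i \in J -> measurable (B i)) ->
  measurable (\bigcap_(i in [set` J]) (Z i @^-1` B i)).
Proof.
move=> mB; apply: bigcap_measurableType => i iJ.
by apply: measurable_funPTI; exact: mB.
Qed.

(** Absorbs a condition on [Z k] into a cylinder event on later indices; as [k] is not in [J],
    overriding [B] at [k] changes no other condition. *)
Lemma indep_cons (k : nat) (J : {fset nat}) (B : nat -> set R) (C : set R) :
    (0 < k)%N -> (forall i, i \in J -> (k < i)%N) ->
    (forall i, i \in J -> measurable (B i)) -> measurable C ->
  let B' i := if i == k then C else B i in
  [/\ \bigcap_(i in [set` (k |` J)%fset]) (Z i @^-1` B' i) =
        Z k @^-1` C `&` \bigcap_(i in [set` J]) (Z i @^-1` B i),
      P (\bigcap_(i in [set` (k |` J)%fset]) (Z i @^-1` B' i)) =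
        (P (Z k @^-1` C) * P (\bigcap_(i in [set` J]) (Z i @^-1` B i)))%E &
      forall i, i \in (k |` J)%fset -> measurable (B' i)].
Proof.
move=> k0 kJ mB mC B'.
have kNJ : k \notin J by apply/negP => /kJ; rewrite ltnn.
have B'J i : i \in J -> B' i = B i.
  by move=> iJ; rewrite /B' ifF//; apply: contraNF kNJ => /eqP <-.
have mB' i : i \in (k |` J)%fset -> measurable (B' i).
  by rewrite !inE /B'; case: eqP => //= _; exact: mB.
split=> //.
- rewrite set_fsetU1 bigcap_setU1 /B' eqxx; congr (_ `&` _).
  by apply: eq_bigcapr => i iJ; rewrite -/(B' i) B'J.
- rewrite Zindep//; last first.
    by move=> i /=; rewrite !inE => /orP[/eqP -> //|/kJ]; exact: leq_trans.
  rewrite big_fsetU1//= {1}/B' eqxx; congr (_ * _)%E.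
  rewrite Zindep//; last by move=> i /= /kJ; exact: leq_trans.
  by rewrite big_seq [RHS]big_seq; apply: eq_bigr => i /B'J ->.
Qed.

(** Carrying a cylinder event on indices beyond [n] makes the induction close: the condition on the
    last variable moves into that event, so only the product formula for cylinders is ever used. *)
Lemma Tsum_law m n (A : set R) (J : {fset nat}) (B : nat -> set R) :
    (m <= n)%N -> measurable A -> (forall i, i \in J -> (n < i)%N) ->
    (forall i, i \in J -> measurable (B i)) ->
  (P (Tsum Z m n @^-1` A `&` \bigcap_(i in [set` J]) (Z i @^-1` B i)) =
   (sumcoef (fun i => \1_A (i%:R : R)) (genf m n))%:E *
   P (\bigcap_(i in [set` J]) (Z i @^-1` B i)))%E.
Proof.
move=> /subnKC <-; elim: (n - m)%N A J B => [|t IHt] A J B mA nJ mB.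
  rewrite addn0 /genf big_geq// sumcoef1 indicE.
  have -> : Tsum Z m m @^-1` A = [set w | A 0].
    by apply/seteqP; split => w /=; rewrite /Tsum big_geq.
  case: (pselect (A 0)) => A0.
    rewrite mem_set// mul1e; congr (P _).
    by apply/seteqP; split => w //= [].
  rewrite memNset// mul0e -(measure0 P); congr (P _).
  by apply/seteqP; split => w //= [].
rewrite addnS in nJ *; set n1 := (m + t).+1 in nJ *.
set E := \bigcap_(i in _) _.
have mE : measurable E by exact: measurable_bigcap_preimage.
(* On [Z n1 = c] the last summand is the constant [n1 * c], so the condition on the sum becomes
   membership of the shorter sum in a translate of [A]. *)
have slice (c : nat) : (P ((Tsum Z m n1 @^-1` A `&` E) `&` Z n1 @^-1` [set c%:R]) =
    (sumcoef (fun i => \1_A ((n1 * c + i)%:R : R)) (genf m (m + t)))%:E *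
    (P (Z n1 @^-1` [set c%:R]) * P E))%E.
  have [capE PcapE mB'] := indep_cons n1 J B [set c%:R] isT nJ mB (measurable_set1 _).
  rewrite -PcapE; set A' := [set x : R | A ((n1 * c)%:R + x)].
  have mA' : measurable A'.
    have mf : measurable_fun setT (fun x : R => (n1 * c)%:R + x) by exact: measurable_funD.
    by rewrite -[A']setTI; exact: mf.
  have -> : (fun i => \1_A ((n1 * c + i)%:R : R)) = (fun i => \1_A' (i%:R : R)) :> (nat -> R).
    by apply: funext => i; rewrite !indicE natrD.
  rewrite -IHt//; last first.
    by move=> i; rewrite !inE => /orP[/eqP -> //|/nJ]; exact: ltn_trans.
  have TsumS w : Tsum Z m n1 w = n1%:R * Z n1 w + Tsum Z m (m + t) w.
    by rewrite /Tsum big_nat_recr ?leq_addr//= addrC.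
  congr (P _); rewrite capE; apply/seteqP; split => w /=; rewrite TsumS /A'/=.
    by move=> [[TA Ew] Zc]; rewrite Zc -natrM in TA.
  by move=> [TA [Zc Ew]]; rewrite Zc -natrM.
have Zn0 : P (Z n1 @^-1` [set 0%N%:R]) = (1 - n1%:R^-1)%:E by exact: Z0.
have Zn1 : P (Z n1 @^-1` [set 1%N%:R]) = (n1%:R^-1)%:E by exact: Z1.
rewrite (@probability_split (Z n1 @^-1` [set 0%N%:R]) (Z n1 @^-1` [set 1%N%:R])).
(* The two slices, weighted by [1 - 1/n1] and [1/n1], are the two terms of [sumcoef_genf1M]. *)
- rewrite !slice Zn0 Zn1 genf_recr ?leq_addr// sumcoef_genf1M muln0 muln1.
  rewrite !muleA -!EFinM -(fineK (fin_num_measure P _ mE)) -!EFinM -EFinD.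
  congr (_%:E); rewrite -/n1; set f0 := (fun i => \1_A (0 + i)%:R).
  rewrite (_ : f0 = (fun i => \1_A (i%:R : R)))//; ring.
- exact: measurable_funPTI.
- exact: measurable_funPTI.
- by apply: measurableI => //; exact: measurable_Tsum_preimage.
- apply/seteqP; split => w //= [-> /eqP]; rewrite eq_sym oner_eq0//.
- by rewrite Zn0 Zn1 -EFinD subrK.
Qed.

Lemma Tsum_prob m n (A : set R) : (m <= n)%N -> measurable A ->
  fine (P (Tsum Z m n @^-1` A)) =
  sumcoef (fun i => \1_A (i%:R : R)) (genf m n).
Proof.
move=> mn mA; have := @Tsum_law m n A fset0 (fun=> setT) mn mA.
rewrite set_fset0 bigcap_set0 setIT probability_setT mule1 => -> //.
Qed.

End TsumLaw.

(** * From coefficients back to probabilities *)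

Theorem proposition3p2 (R : realType) (d : measure_display)
    (Omega : measurableType d) (P : probability Omega R)
    (Z : nat -> {RV P >-> R})
    (Zindep : mutually_independent [set k : nat | (1 <= k)%N] Z)
    (Z1 : forall k : nat, (1 <= k)%N ->
      P [set w | Z k w = 1] = ((k%:R)^-1)%:E)
    (Z0 : forall k : nat, (1 <= k)%N ->
      P [set w | Z k w = 0] = (1 - (k%:R)^-1)%:E)
    (kappa : nat -> int)
    (kappa_incr : forall i j : nat, (i <= j)%N -> kappa i <= kappa j) :
  exists2 C : R, 0 < C &
    forall m n : nat, (2 <= m)%N -> (m < n)%N ->
      let D : R := (kappa n - kappa m)%:~R in
      `| D * fine (P [set w | Tsum Z m n w = D])
         - fine (P [set w | D - n%:R <= Tsum Z m n w <= D - (m.+1)%:R]) |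
      <= C * ((1 + ln (n%:R / m%:R)) / Num.sqrt (n - m)%:R).
Proof.
(* The larger of the constants 3 and [9/2] in [size_bias_error_le]. *)
exists (9 / 2); first by lra.
move=> m n m2 mn; cbv zeta; set D : R := (kappa n - kappa m)%:~R.
have [j Dj] : exists j : nat, D = j%:R.
  exists `|kappa n - kappa m|%N; rewrite /D -[in LHS](@gez0_abs (kappa n - kappa m))//.
  by rewrite subr_ge0 kappa_incr// ltnW.
have -> : fine (P [set w | Tsum Z m n w = D]) = (genf m n)`_j.
  rewrite (Tsum_prob Z Zindep Z1 Z0 m n [set D] (ltnW mn) (measurable_set1 _)).
  rewrite -sumcoef_eq; congr sumcoef; apply: funext => i.
  rewrite indicE Dj; congr (nat_of_bool _)%:R; apply/idP/eqP => [|->].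
    by rewrite inE/= => /eqP; rewrite eqr_nat => /eqP.
  by rewrite inE.
have -> : fine (P [set w | D - n%:R <= Tsum Z m n w <= D - m.+1%:R]) =
    \sum_(m.+1 <= k < n.+1) (genf m n * 'X^k)`_j.
  have -> : [set w | D - n%:R <= Tsum Z m n w <= D - m.+1%:R] =
      Tsum Z m n @^-1` `[D - n%:R, D - m.+1%:R].
    by apply/seteqP; split => w /=; rewrite in_itv.
  rewrite (Tsum_prob Z Zindep Z1 Z0 m n _ (ltnW mn) (measurable_itv _)).
  (* The value [i] lies in the interval exactly when [j - i] is one of [m + 1, ..., n], that is,
     when exactly one such [k] satisfies [k + i = j]. Each [k] then contributes a coefficient of the
     generating function shifted by ['X^k]. *)
  have -> : (fun i => \1_(`[D - n%:R, D - m.+1%:R]) (i%:R : R)) =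
      (fun i => \sum_(m.+1 <= k < n.+1) (k + i == j)%:R) :> (nat -> R).
    apply: funext => i; rewrite indicE mem_setE in_itv/= Dj.
    rewrite lerBlDr lerBrDr -!natrD !ler_nat.
    have [ij|ji] := leqP i j.
      rewrite (eq_bigr (fun k => if k == (j - i)%N then 1 else 0)); last first.
        by move=> k _; rewrite (_ : (k + i == j) = (k == j - i)%N); [case: eqP|lia].
      rewrite -big_mkcond big_nat1_eq.
      rewrite (_ : (_ && _) = (m.+1 <= j - i < n.+1)%N); last by lia.
      by case: ifP.
    rewrite big1 => [|k _]; first by rewrite (_ : _ && _ = false)//; lia.
    by rewrite (_ : _ == _ = false)//; lia.
  rewrite sumcoef_sum; apply: eq_bigr => k _.
  by rewrite -sumcoef_eq sumcoefMXn.
rewrite Dj; have mn2 : (2 <= m < n)%N by rewrite m2.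
apply: le_trans (size_bias_error_le m n j mn2) _.
have nm0 : 0 < (n - m)%:R :> R by rewrite ltr0n subn_gt0.
(* Here [sqrt (n - m) <= n], because [n - m <= n^2]. *)
have sn : n%:R^-1 <= (Num.sqrt (n - m)%:R)^-1 :> R.
  rewrite lef_pV2 ?posrE ?sqrtr_gt0// ?ltr0n; last by lia.
  rewrite -[leRHS]ger0_norm ?ler0n// -sqrtr_sqr ler_wsqrtr// -natrX ler_nat; nia.
have hl := @sum_inv_le_ln R m n ltac:(lia).
rewrite [leRHS]mulrA [leRHS]mulrC; apply: ler_pM => //.
- by rewrite addr_ge0// mulr_ge0 ?sumr_ge0//; lra.
- lra.
Qed.
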